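(* Let $a\in\mathbb{R}$ and $b>0$ be constants. Let $\mathbf U(t),\mathbf W(t)\in\mathbb{R}^{2P+2}$ be a solution of the semi-discrete two-element interface scheme $$\frac{d}{dt}\mathbf U=a\widetilde{\mathbf D}\mathbf U+\mathbf W,\qquad \frac{d}{dt}\mathbf W=\widetilde{\mathbf D}(a\mathbf W)-\mathbf H^{-1}\mathbf A_b\mathbf U,$$ for which the external boundary contributions vanish, i.e. $\mathbf W^T\widetilde{\mathbf B}\mathbf W=0$ and $(\widetilde{\mathbf D}\mathbf U)^T\widetilde{\mathbf B}(\widetilde{\mathbf D}\mathbf U)=0$ for all $t$. Then the discrete energy $$\mathcal E_b(t)=\langle\mathbf W,\mathbf W\rangle_{\mathbf H}+\mathbf U^T\mathbf A_b\mathbf U$$ satisfies $\frac{d}{dt}\mathcal E_b(t)=0$.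
   Context: Element operators: let $P\ge 1$, let $-1=\xi_1<\dots<\xi_{P+1}=1$ be the Gauss-Legendre-Lobatto nodes on $[-1,1]$ with positive weights $\omega_j$ (quadrature exact for polynomials of degree $\le 2P-1$), and let $\phi_i$ be the Lagrange polynomials of degree $P$ with $\phi_i(\xi_j)=\delta_{ij}$. Set $Q_{ij}=\sum_m\omega_m\phi_i(\xi_m)\phi_j'(\xi_m)$; for an element of length $\Delta x>0$ set $H_x=\frac{\Delta x}{2}\mathrm{diag}(\omega_1,\dots,\omega_{P+1})$, $D_x=H_x^{-1}Q$. Two-element operators: the domain is $[B_-,B_+]=\Omega_-\cup\Omega_+$, two elements of length $\Delta x$ meeting at $x_I$; grid vectors in $\mathbb{R}^{2P+2}$ list first the $P+1$ nodal values on $\Omega_-$, then those on $\Omega_+$ (the node $x_I$ is doubled). With $e_l=(1,0,\dots,0)^T$, $e_r=(0,\dots,0,1)^T\in\mathbb{R}^{P+1}$, $$\mathbf H=\begin{pmatrix}H_x&0\\0&H_x\end{pmatrix},\quad \mathbf D=\begin{pmatrix}D_x&0\\0&D_x\end{pmatrix},\quad \widehat{\mathbf B}=\begin{pmatrix}e_re_r^T&-e_re_l^T\\ e_le_r^T&-e_le_l^T\end{pmatrix},\quad \widetilde{\mathbf B}=\begin{pmatrix}-e_le_l^T&0\\0&e_re_r^T\end{pmatrix},$$ $\widetilde{\mathbf D}=\mathbf D-\frac12\mathbf H^{-1}\widehat{\mathbf B}$, $\langle\mathbf U,\mathbf V\rangle_{\mathbf H}=\mathbf V^T\mathbf H\mathbf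 U$. With $\mathbf b=bI$, $$\mathbf A_b=\mathbf D^T\mathbf b\mathbf H\mathbf D-\tfrac12\big(\widehat{\mathbf B}^T\mathbf b\mathbf D+\mathbf D^T\mathbf b\widehat{\mathbf B}\big)+\tfrac14\widehat{\mathbf B}^T\mathbf b\mathbf H^{-1}\widehat{\mathbf B}.$$ The scheme discretises the shifted wave equation $\partial_t(u_t-au_x)-\partial_x(a(u_t-au_x)+bu_x)=0$; contributions from the external boundaries $B_\pm$ are ignored. *)

(* Defs.v *)
From HB Require Import structures.
From mathcomp Require Import all_boot all_order all_algebra.
From mathcomp Require Import all_classical all_reals all_analysis.

Set Implicit Arguments.
Unset Strict Implicit.
Unset Printing Implicit Defensive.

Import Order.TTheory GRing.Theory Num.Theory numFieldNormedType.Exports.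

Local Open Scope classical_set_scope.
Local Open Scope ring_scope.

(* Rodrigues' formula: L_n = (2^n n!)^-1 (d/dX)^n (X^2 - 1)^n. *)
Definition legendre (R : realType) (n : nat) : {poly R} :=
  (2 ^+ n * n`!%:R)^-1 *: (('X^2 - 1) ^+ n)^`(n).

(* The interior Lobatto nodes are the P - 1 roots of L_P', whence the          *)
(* interior clause; together with strict monotonicity and the endpoints it     *)
(* determines xi, and exactness in degree <= 2P - 1 then determines w.         *)
Record gauss_legendre_lobatto (R : realType) (P : nat)
    (xi w : 'I_P.+1 -> R) : Prop := GaussLegendreLobatto {
  gll_increasing : forall i j : 'I_P.+1, (i < j)%N -> xi i < xi j;
  gll_first : xi ord0 = -1;
  gll_last : xi ord_max = 1;
  gll_interior : forall i : 'I_P.+1, i != ord0 -> i != ord_max ->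
    root (legendre R P)^`() (xi i);
  gll_weight_gt0 : forall j : 'I_P.+1, 0 < w j;
  (* [size p <= 2 * P] means [deg p <= 2P - 1]. *)
  gll_exact : forall p : {poly R}, (size p <= 2 * P)%N ->
    \sum_(j < P.+1) w j * p.[xi j] =
    \int[lebesgue_measure]_(x in `[(-1 : R), 1]) p.[x]
}.

(* The library's [lagrange] needs sampling points injective on all of [nat];   *)
(* here they are indexed by ['I_P.+1].                                         *)
Definition lagrange_poly (R : realType) (P : nat) (xi : 'I_P.+1 -> R)
    (i : 'I_P.+1) : {poly R} :=
  \prod_(j < P.+1 | j != i) ((xi i - xi j)^-1 *: ('X - (xi j)%:P)).

Lemma lagrange_poly_node (R : realType) (P : nat) (xi : 'I_P.+1 -> R) :
  injective xi -> forall i j, (lagrange_poly xi i).[xi j] = (i == j)%:R.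
Proof.
move=> xi_inj i j; rewrite /lagrange_poly horner_prod.
have [<-|neq_ij] := eqVneq i j.
  by apply: big1 => k kNi; rewrite !hornerE mulVf // subr_eq0 inj_eq // eq_sym.
by rewrite (bigD1 j) 1?eq_sym //= !hornerE subrr mulr0 mul0r.
Qed.

Lemma size_lagrange_poly (R : realType) (P : nat) (xi : 'I_P.+1 -> R) :
  injective xi -> forall i, size (lagrange_poly xi i) = P.+1.
Proof.
move=> xi_inj i.
have xiN0 j : j != i -> (xi i - xi j)^-1 != 0.
  by move=> jNi; rewrite invr_eq0 subr_eq0 inj_eq // eq_sym.
rewrite size_prod => [|j jNi]; last first.
  by rewrite scaler_eq0 negb_or xiN0 // polyXsubC_eq0.
rewrite (eq_bigr (fun=> 2)) => [|j jNi]; last first.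
  by rewrite size_scale ?xiN0 // size_XsubC.
by rewrite sum_nat_const cardC1 card_ord muln2 -addnn -addSn addnK.
Qed.

Section ElementOperators.
Variables (R : realType) (P : nat) (xi w : 'I_P.+1 -> R) (dx : R).

Definition Q_mx : 'M[R]_P.+1 :=
  \matrix_(i, j) \sum_(m < P.+1)
    w m * (lagrange_poly xi i).[xi m] * (lagrange_poly xi j)^`().[xi m].

Definition Hx_mx : 'M[R]_P.+1 := (dx / 2) *: diag_mx (\row_j w j).

Definition Dx_mx : 'M[R]_P.+1 := invmx Hx_mx *m Q_mx.

End ElementOperators.

Definition e_l (R : realType) (P : nat) : 'cV[R]_P.+1 := delta_mx ord0 0.
Definition e_r (R : realType) (P : nat) : 'cV[R]_P.+1 := delta_mx ord_max 0.

(* Grid vectors have type ['cV[R]_(P.+1 + P.+1)]: the nodal values on the left *)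
(* element, then those on the right one.                                       *)
Section TwoElementOperators.
Variables (R : realType) (P : nat) (xi w : 'I_P.+1 -> R) (dx : R).

Let el := e_l R P.
Let er := e_r R P.

Definition H_mx : 'M[R]_(P.+1 + P.+1) :=
  block_mx (Hx_mx w dx) 0 0 (Hx_mx w dx).

Definition D_mx : 'M[R]_(P.+1 + P.+1) :=
  block_mx (Dx_mx xi w dx) 0 0 (Dx_mx xi w dx).

Definition Bhat_mx : 'M[R]_(P.+1 + P.+1) :=
  block_mx (er *m er^T) (- (er *m el^T)) (el *m er^T) (- (el *m el^T)).

Definition Btilde_mx : 'M[R]_(P.+1 + P.+1) :=
  block_mx (- (el *m el^T)) 0 0 (er *m er^T).

Definition Dtilde_mx : 'M[R]_(P.+1 + P.+1) :=
  D_mx - 2^-1 *: (invmx H_mx *m Bhat_mx).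

Definition A_mx (b : R) : 'M[R]_(P.+1 + P.+1) :=
  D_mx^T *m b%:M *m H_mx *m D_mx
  - 2^-1 *: (Bhat_mx^T *m b%:M *m D_mx + D_mx^T *m b%:M *m Bhat_mx)
  + 4^-1 *: (Bhat_mx^T *m b%:M *m invmx H_mx *m Bhat_mx).

Definition dot_H (U V : 'cV[R]_(P.+1 + P.+1)) : R :=
  (V^T *m H_mx *m U) 0 0.

Definition energy (b : R) (U W : 'cV[R]_(P.+1 + P.+1)) : R :=
  dot_H W W + (U^T *m A_mx b *m U) 0 0.

End TwoElementOperators.

Arguments Bhat_mx R P : clear implicits.
Arguments Btilde_mx R P : clear implicits.

(* Main.v *)
(* Write Dt for the averaged derivative. Exactness of the Lobatto quadrature   *)
(* gives Q + Q^T = e_r e_r^T - e_l e_l^T on each element; subtracting half of  *)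
(* Bhat, whose off-diagonal blocks are skew, cancels the contributions at the  *)
(* interface, so that H Dt + Dt^T H = Btilde. As A_b = b Dt^T H Dt, the mixed  *)
(* terms in U and W cancel in the energy rate, which leaves                    *)
(* a W^T Btilde W + a b (Dt U)^T Btilde (Dt U) = 0.                            *)

Require Import Defs.
From HB Require Import structures.
From mathcomp Require Import all_boot all_order all_algebra.
From mathcomp Require Import ring zify.
From mathcomp Require Import all_classical all_reals all_analysis.

Set Implicit Arguments.
Unset Strict Implicit.
Unset Printing Implicit Defensive.

Import Order.TTheory GRing.Theory Num.Theory numFieldNormedType.Exports.

Local Open Scope classical_set_scope.
Local Open Scope ring_scope.

(** This is the energy method. Calculus enters only through the fundamental theorem for polynomials,
    behind [Q_mx_sbp], and the product rule for quadratic forms. The rest is matrix algebra: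
    [Dtilde_sbp] and the factorisation [A_mxE] feed [energy_rate], which reduces the rate to two
    boundary forms, both zero by hypothesis. *)

Lemma integral_deriv_poly (R : realType) (p : {poly R}) (x y : R) : x < y ->
  \int[lebesgue_measure]_(z in `[x, y]) p^`().[z] = p.[y] - p.[x].
Proof.
move=> xy; rewrite /Rintegral (@continuous_FTC2 _ _ (horner p)) //.
- by apply: continuous_subspaceT => z; exact: continuous_horner.
- split=> [z _| |]; first exact: derivable_horner.
  + by apply: cvg_at_right_filter; exact: continuous_horner.
  + by apply: cvg_at_left_filter; exact: continuous_horner.
- by move=> z _; rewrite -derivE.
Qed.

Lemma is_derive_quadratic_form (R : realType) (n : nat) (M : 'M[R]_n)
  (V : R -> 'cV[R]_n) (dV : 'cV[R]_n) (t : R) :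
  is_derive t 1 V dV ->
  is_derive t 1 (fun s => ((V s)^T *m M *m V s) 0 0)
    ((dV^T *m M *m V t + (V t)^T *m M *m dV) 0 0).
Proof.
move=> V'; have dVt : derivable V t 1 by exact: ex_derive.
have coordV i : is_derive t 1 (fun s => V s i 0) (dV i 0).
  apply: DeriveDef; first by move/derivable_mxP: dVt.
  by rewrite -(@derive_val _ _ _ _ _ _ _ V') derive_mx // mxE.
(* As a finite sum of products of scalar functions, the form can be differentiated by instance
   inference. *)
have -> : (fun s => ((V s)^T *m M *m V s) 0 0) =
    \sum_j \sum_i (fun s => V s i 0) * (M i j \*: (fun s => V s j 0)).
  apply/funext => s; rewrite mxE fct_sumE; apply: eq_bigr => j _.
  rewrite mxE mulr_suml fct_sumE; apply: eq_bigr => i _.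
  by rewrite mxE -mulrA.
apply: is_derive_eq.
rewrite [RHS]mxE ![in RHS](mxE _ _ 0 0) -big_split; apply: eq_bigr => j _ /=.
rewrite !mxE !mulr_suml -big_split; apply: eq_bigr => i _ /=.
by rewrite !mxE /GRing.scale /=; ring.
Qed.

Section SummationByParts.
Context (R : realType) (P : nat) (xi w : 'I_P.+1 -> R)
  (gll : gauss_legendre_lobatto xi w).

Lemma gll_inj : injective xi.
Proof.
move=> i j xi_eq; apply/val_inj.
by case: (ltngtP i j) => // /(gll_increasing gll); rewrite xi_eq ltxx.
Qed.

(* [phi_i phi_j] has degree at most [2P], so the quadrature integrates its     *)
(* derivative exactly.                                                         *)
Lemma Q_mx_sbp :
  Q_mx xi w + (Q_mx xi w)^T = e_r R P *m (e_r R P)^T - e_l R P *m (e_l R P)^T.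
Proof.
apply/matrixP => i j; pose p := lagrange_poly xi i * lagrange_poly xi j.
have szp : (size p^`() <= 2 * P)%N.
  apply: leq_trans (size_poly _ _) _.
  have := size_polyMleq (lagrange_poly xi i) (lagrange_poly xi j).
  by rewrite !(size_lagrange_poly gll_inj) -/p; lia.
have := gll_exact gll szp.
(* The endpoints are nodes, so the boundary values of [p] become products of Kronecker deltas. *)
rewrite integral_deriv_poly ?gtrN // -[in p.[1]](gll_last gll).
rewrite -[in p.[-1]](gll_first gll) !hornerM !(lagrange_poly_node gll_inj).
move=> pE; rewrite /e_l /e_r !trmx_delta !mul_delta_mx !mxE.
rewrite -!natrM !mulnb in pE; rewrite -pE -big_split /=; apply: eq_bigr => m _.
by rewrite derivM !hornerE; ring.
Qed.

Context (dx : R) (dx_gt0 : 0 < dx).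

Lemma Hx_unit : Hx_mx w dx \in unitmx.
Proof.
rewrite /Hx_mx unitmxE detZ det_diag unitfE mulf_neq0 //.
  by rewrite expf_neq0 // gt_eqF // divr_gt0.
by apply/prodf_neq0 => i _; rewrite mxE gt_eqF // (gll_weight_gt0 gll).
Qed.

Lemma H_unit : H_mx w dx \in unitmx.
Proof. by rewrite /H_mx unitmxE det_ublock unitrM -!unitmxE Hx_unit. Qed.

Lemma H_sym : (H_mx w dx)^T = H_mx w dx.
Proof. by rewrite /H_mx tr_block_mx !trmx0 /Hx_mx linearZ /= tr_diag_mx. Qed.

Lemma H_D_mx : H_mx w dx *m D_mx xi w dx = block_mx (Q_mx xi w) 0 0 (Q_mx xi w).
Proof.
rewrite mulmx_block !mulmx0 !mul0mx !addr0 add0r.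
by rewrite /Dx_mx mulKVmx ?Hx_unit.
Qed.

Lemma Dtilde_sbp :
  H_mx w dx *m Dtilde_mx xi w dx + (Dtilde_mx xi w dx)^T *m H_mx w dx
  = Btilde_mx R P.
Proof.
(* By symmetry of [H_mx] the second summand is the transpose of the first. *)
rewrite -[X in _ + _ *m X]H_sym -trmx_mul.
rewrite mulmxBr -scalemxAr mulKVmx ?H_unit // H_D_mx.
rewrite [(_ - _)^T]linearB /= [(_ *: _)^T]linearZ /= addrACA -opprD -scalerDr.
rewrite !tr_block_mx !add_block_mx.
rewrite !linearN /= !trmx_mul !trmxK !trmx0 Q_mx_sbp !addr0 addNr subrr.
rewrite scale_block_mx !scaler0 opp_block_mx add_block_mx !oppr0 !addr0.
have half (x : 'M[R]_P.+1) : 2^-1 *: (x + x) = x.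
  by rewrite -mulr2n -[x *+ 2]scaler_nat scalerA mulVf ?scale1r ?pnatr_eq0.
by rewrite -opprD scalerN !half opprK subrK addrAC subrr add0r.
Qed.

(** Completing the square: the cross terms of the product give the factor 1/2, and the squared
    interface correction gives 1/4. *)
Lemma A_mxE (b : R) : A_mx xi w dx b =
  b *: ((Dtilde_mx xi w dx)^T *m H_mx w dx *m Dtilde_mx xi w dx).
Proof.
rewrite /A_mx /Dtilde_mx !mul_mx_scalar.
set H := H_mx w dx; set D := D_mx xi w dx; set B := Bhat_mx R P.
have HT : (invmx H)^T = invmx H by rewrite trmx_inv H_sym.
have -> : (D - 2^-1 *: (invmx H *m B))^T = D^T - 2^-1 *: (B^T *m invmx H).
  by rewrite [LHS]linearB /= [(_ *: _)^T]linearZ /= trmx_mul HT.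
rewrite !mulmxBl !mulmxBr -!(scalemxAl, scalemxAr) -!mulmxA.
rewrite !mulKmx ?mulKVmx ?H_unit //.
set DHD := D^T *m _; set BD := B^T *m D; set DB := D^T *m B.
set BHB := B^T *m _.
by apply/matrixP => i j; rewrite !(mxE _ _ i j) /=; field.
Qed.

End SummationByParts.

(** The [U] part rests on [A D + D^T A = b D^T (H D + D^T H) D], so summation by parts applies a
    second time, to [D U]. *)
Lemma energy_rate (R : comUnitRingType) (n : nat) (H D A B : 'M[R]_n) (a b : R)
  (U W : 'cV[R]_n) : H \in unitmx -> H^T = H -> H *m D + D^T *m H = B ->
  A = b *: (D^T *m H *m D) ->
  let dU := a *: (D *m U) + W in
  let dW := D *m (a *: W) - invmx H *m A *m U in
  (dW^T *m H *m W + W^T *m H *m dW) + (dU^T *m A *m U + U^T *m A *m dU) =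
  a *: (W^T *m B *m W) + (a * b) *: ((D *m U)^T *m B *m (D *m U)).
Proof.
move=> Hu HT HD AE dU dW.
have AT : A^T = A by rewrite AE linearZ /= !trmx_mul HT trmxK mulmxA.
have HdW : H *m dW = a *: (H *m D *m W) - A *m U.
  by rewrite mulmxBr -scalemxAr -scalemxAr !mulmxA mulmxV // mul1mx.
have dWH : dW^T *m H = a *: (W^T *m D^T *m H) - U^T *m A.
  rewrite -[H in LHS]HT -trmx_mul HdW linearB linearZ /= !trmx_mul.
  by rewrite HT AT mulmxA.
rewrite dWH -(mulmxA W^T H dW) HdW.
have -> : dU^T = a *: (U^T *m D^T) + W^T by rewrite linearD linearZ /= trmx_mul.
rewrite -HD /dU {dU dW dWH HdW AT}.
rewrite !(mulmxDl, mulmxDr, mulNmx, mulmxN) -!scalemxAl -!scalemxAr !mulmxA.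
(* The coupling [- A U] in [H dW] cancels against the term [W] in [dU]; only the advection terms
   remain. *)
have -> : a *: (W^T *m D^T *m H *m W) - U^T *m A *m W
    + (a *: (W^T *m H *m D *m W) - W^T *m A *m U)
    + (a *: (U^T *m D^T *m A *m U) + W^T *m A *m U
       + (a *: (U^T *m A *m D *m U) + U^T *m A *m W)) =
  a *: (W^T *m H *m D *m W) + a *: (W^T *m D^T *m H *m W)
    + (a *: (U^T *m A *m D *m U) + a *: (U^T *m D^T *m A *m U)).
  by apply/matrixP => i j; rewrite !(mxE, mulr_suml, mulr_sumr); ring.
rewrite -!scalerDr -scalerA -scalerDr; congr (_ *: (_ + _)).
by rewrite AE trmx_mul -!(scalemxAl, scalemxAr) -scalerDr !mulmxA.
Qed.

Theorem theorem11 (R : realType) (P : nat) (P_ge1 : (1 <= P)%N)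
  (xi w : 'I_P.+1 -> R) (gll : gauss_legendre_lobatto xi w)
  (dx : R) (dx_gt0 : 0 < dx) (a b : R) (b_gt0 : 0 < b)
  (J : set R) (J_open : open J)
  (U W : R -> 'cV[R]_(P.+1 + P.+1))
  (U_eq : forall t : R, J t ->
     is_derive t 1 U (a *: (Dtilde_mx xi w dx *m U t) + W t))
  (W_eq : forall t : R, J t ->
     is_derive t 1 W (Dtilde_mx xi w dx *m (a *: W t)
                      - invmx (H_mx w dx) *m A_mx xi w dx b *m U t))
  (W_bd : forall t : R, J t -> (W t)^T *m Btilde_mx R P *m W t = 0)
  (DU_bd : forall t : R, J t ->
     (Dtilde_mx xi w dx *m U t)^T *m Btilde_mx R P
       *m (Dtilde_mx xi w dx *m U t) = 0) :
  forall t : R, J t ->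
    is_derive t 1 (fun s : R => energy xi w dx b (U s) (W s)) 0.
Proof.
move=> t Jt; rewrite /energy /dot_H.
have dW := is_derive_quadratic_form (H_mx w dx) (W_eq t Jt).
have dU := is_derive_quadratic_form (A_mx xi w dx b) (U_eq t Jt).
apply: is_derive_eq (is_deriveD dW dU) _.
have /matrixP/(_ 0 0) := energy_rate a (U t) (W t) (H_unit gll dx_gt0)
  (H_sym _ _) (Dtilde_sbp gll dx_gt0) (A_mxE gll dx_gt0 b).
by rewrite W_bd // DU_bd // !scaler0 addr0 [LHS]mxE [RHS]mxE.
Qed.
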